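(* For any $0\neq f\in\mathcal{H}$, the vacuum distribution of the field operator $Q(f)=A(f)+A^+(f)$ on $\Gamma_{q,2}(\mathcal{H})$ is 1) the two-point law on the set $\{-\Vert f\Vert,\Vert f\Vert\}$ with equal probabilities $\frac12$, if $q=-1$; 2) the semi-circle law over the interval $(-2\Vert f\Vert,2\Vert f\Vert)$, i.e. the probability measure with density $x\mapsto\frac{1}{2\pi\Vert f\Vert^2}\sqrt{4\Vert f\Vert^2-x^2}\,\chi_{(-2\Vert f\Vert,2\Vert f\Vert)}(x)$, if $q=0$.
   Context: $\mathcal{H}$ is a (complex) Hilbert space of dimension at least $2$ with scalar product $\langle\cdot,\cdot\rangle$, and $q\in[-1,1]$. Let $\langle\cdot,\cdot\rangle_{\otimes n}$ be the standard scalar product on $\mathcal{H}^{\otimes n}$. Define operators $\lambda_1:=\mathbf{1}_{\mathcal{H}}$; $\lambda_2$ on $\mathcal{H}^{\otimes2}$, the linear operator with $\lambda_2(f\otimes g)=f\otimes g+q\,g\otimes f$; and $\lambda_{n+2}:=\mathbf{1}_{\mathcal{H}}^{\otimes n}\otimes\lambda_2$ on $\mathcal{H}^{\otimes(n+2)}$ for $n\ge1$. These are positive. For $n\ge1$ let $\mathcal{H}_n$ be the Hilbert space obtained by quotienting $(\mathcal{H}^{\otimes n},\langle\cdot,\lambda_n\cdot\rangle_{\otimes n})$ by the null space and completing; $\mathcal{H}_0:=\mathbb{C}$. The $(\mathbf{q},2)$-Fock space is $\Gamma_{q,2}(\mathcal{H}):=\bigoplus_{n\ge0}\mathcal{H}_n$,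 with vacuum vector $\Phi:=1\oplus0\oplus0\oplus\cdots$. For $f\in\mathcal{H}$ the creation operator $A^+(f)$ is the bounded linear operator with $A^+(f)\Phi:=f$ and $A^+(f)F:=f\otimes F$ for $F\in\mathcal{H}_n$, $n\ge1$; the annihilation operator is its adjoint $A(f):=(A^+(f))^*$. Explicitly, $A(f)\Phi=0$, $A(f)g_1=\langle f,g_1\rangle\Phi$, $A(f)(g_1\otimes g_2)=\langle f,g_1\rangle g_2+q\langle f,g_2\rangle g_1$, and $A(f)(g_1\otimes\cdots\otimes g_n)=\langle f,g_1\rangle g_2\otimes\cdots\otimes g_n$ for $n>2$. The field operator is $Q(f):=A(f)+A^+(f)$, a bounded self-adjoint operator. The (vacuum) distribution of a bounded self-adjoint operator $X$ is the unique probability measure $\mu$ on $\mathbb{R}$ with $\int x^n\,d\mu=\langle\Phi,X^n\Phi\rangle$ for all $n\in\mathbb{N}=\{0,1,2,\ldots\}$. $\chi_S$ denotes the indicator function of $S$. *)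

(* Defs.v *)
From HB Require Import structures.
From mathcomp Require Import all_boot all_order all_algebra.
From mathcomp Require Export complex.
From mathcomp Require Import all_classical all_reals all_analysis.
From mathcomp Require Import measurable_realfun.

Set Implicit Arguments.
Unset Strict Implicit.
Unset Printing Implicit Defensive.

Import Order.TTheory GRing.Theory Num.Theory.
Import numFieldNormedType.Exports.

Local Open Scope classical_set_scope.
Local Open Scope ring_scope.
Local Open Scope complex_scope.

(* Complex Hilbert spaces: complete normed spaces over R[i] whose norm comes   *)
(* from a scalar product. The forms {dot V for _} of the library are linear in *)
(* their first argument; the scalar product [inner u v] is linear in v.        *)
HB.mixin Record NormedModule_isHilbert (R : realType) V
    of CompleteNormedModule R[i] V := {
  hdot : {dot V for (@Num.conj R[i])} ;
  hdot_norm : forall u : V, hdot u u = `|u| ^+ 2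
}.

#[short(type="hilbertType")]
HB.structure Definition Hilbert (R : realType) :=
  {V of NormedModule_isHilbert R V & CompleteNormedModule R[i] V}.

Definition inner (R : realType) (V : hilbertType R) (u v : V) : R[i] := hdot v u.

Notation "[< u , v >]" := (inner u v)
  (at level 0, u, v at level 99, format "[< u ,  v >]") : ring_scope.

(* The library norm takes its values in R[i]. *)
Definition hnorm (R : realType) (V : hilbertType R) (u : V) : R := complex.Re `|u|.

Section HilbertConstructions.
Variable R : realType.

Definition linear_span (V : hilbertType R) (S : set V) : set V :=
  [set v | exists (k : nat) (a : 'I_k -> R[i]) (s : 'I_k -> V),
     (forall i, S (s i)) /\ v = \sum_(i < k) a i *: s i].

Definition total (V : hilbertType R) (S : set V) := dense (linear_span S).

(* The Hilbert spaces H^{(x) n}, n >= 0, with the map                          *)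
(* (f_1, ..., f_n) |-> f_1 (x) ... (x) f_n. These data are determined up to a  *)
(* unitary isomorphism. Multilinearity of tens follows from tens_inner; the    *)
(* empty tensor is a unit vector spanning H^{(x) 0} = C.                       *)
Structure tensor_powers (H : hilbertType R) := TensorPowers {
  tpow : nat -> hilbertType R ;
  tens : forall n, n.-tuple H -> tpow n ;
  tens_inner : forall n (f g : n.-tuple H),
    [< tens f, tens g >] = \prod_(i < n) [< tnth f i, tnth g i >] ;
  tens_total : forall n, total (range (@tens n))
}.

(* The Hilbert space obtained from V with the positive form <. , L .> by       *)
(* dividing out the null space and completing; sep_class sends a vector to its *)
(* class, so that its kernel is the null space by sep_inner.                   *)
Structure separated_completion (V : hilbertType R) (L : V -> V) :=
    SeparatedCompletion {
  sep_space : hilbertType R ;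
  sep_class : {linear V -> sep_space} ;
  sep_inner : forall u v, [< sep_class u, sep_class v >] = [< u, L v >] ;
  sep_dense : dense (range sep_class)
}.

Structure hilbert_sum (K : nat -> hilbertType R) := HilbertSum {
  hsum_space : hilbertType R ;
  hsum_in : forall n, {linear K n -> hsum_space} ;
  hsum_inner : forall n (u v : K n), [< hsum_in n u, hsum_in n v >] = [< u, v >] ;
  hsum_ortho : forall m n (u : K m) (v : K n), m <> n ->
    [< hsum_in m u, hsum_in n v >] = 0 ;
  hsum_total : total (\bigcup_n range (hsum_in n))
}.

End HilbertConstructions.

Section FockSpace.
Variables (R : realType) (H : hilbertType R) (q : R).

(* lambda_n for n >= 1; on H^{(x) 0} = C it is the identity, so that H_0 = C.  *)
Definition is_lambda (T : tensor_powers H)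
    (lam : forall n, {linear tpow T n -> tpow T n}) :=
  [/\ forall n, continuous (lam n),
      lam 0%N =1 id, lam 1%N =1 id &
      forall n (u : n.-tuple H) (f g : H),
        lam (n + 2)%N (tens T [tuple of u ++ [tuple f; g]]) =
        tens T [tuple of u ++ [tuple f; g]] +
        q%:C *: tens T [tuple of u ++ [tuple g; f]]].

(* Each step (tensor powers, quotient and completion, orthogonal sum) is given *)
(* by the property that characterizes it up to a unique unitary isomorphism,   *)
(* so that a fock_space is a model of the (q,2)-Fock space; statements are     *)
(* meant to quantify over all models.                                          *)
Structure fock_space := FockSpace {
  fock_tpow : tensor_powers H ;
  fock_lambda : forall n, {linear tpow fock_tpow n -> tpow fock_tpow n} ;
  fock_lambdaP : is_lambda fock_lambda ;
  fock_part : forall n, separated_completion (fock_lambda n) ;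
  fock_sum : hilbert_sum (fun n => sep_space (fock_part n))
}.

Variable F : fock_space.

Definition fock_carrier : hilbertType R := hsum_space (fock_sum F).

Definition fock_tens n (g : n.-tuple H) : fock_carrier :=
  hsum_in (fock_sum F) n (sep_class (fock_part F n) (tens (fock_tpow F) g)).

Definition vacuum : fock_carrier := fock_tens [tuple].

(* By linearity and continuity A^+(f) is determined by its values on Phi and   *)
(* on the elementary tensors, which are total.                                 *)
Definition is_creation (f : H) (Ap : {linear fock_carrier -> fock_carrier}) :=
  [/\ continuous Ap,
      Ap vacuum = fock_tens [tuple f] &
      forall n (g : n.+1.-tuple H),
        Ap (fock_tens g) = fock_tens [tuple of f :: g]].

End FockSpace.

Definition is_adjoint (R : realType) (V : hilbertType R) (A B : V -> V) :=
  forall u v, [< A u, v >] = [< u, B v >].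

Definition field_operator (R : realType) (V : hilbertType R) (Am Ap : V -> V) :
  V -> V := fun u => Am u + Ap u.

Section Distribution.
Variables (R : realType) (V : hilbertType R).

(* The moments determine the law of a bounded self-adjoint operator: it is the *)
(* unique probability measure satisfying has_moments.                          *)
Definition has_moments (Phi : V) (X : V -> V)
    (mu : {measure set (measurableTypeR R) -> \bar R}) :=
  mu setT = 1%E /\
  forall n : nat,
    mu.-integrable setT (fun x : R => (x ^+ n)%:E) /\
    (\int[mu]_x (x ^+ n))%:C = [< Phi, iter n X Phi >].

Definition is_distribution (Phi : V) (X : V -> V)
    (mu : {measure set (measurableTypeR R) -> \bar R}) :=
  has_moments Phi X mu /\
  forall nu : probability (measurableTypeR R) R, has_moments Phi X nu ->
    forall A, measurable A -> nu A = mu A.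

End Distribution.

Section Laws.
Variable R : realType.
Implicit Type r : R.

Definition two_point_law r : {measure set (measurableTypeR R) -> \bar R} :=
  measure_add (mscale (2^-1)%:nng (\d_(- r : measurableTypeR R)))
              (mscale (2^-1)%:nng (\d_(r : measurableTypeR R))).

Definition semicircle_pdf r (x : R) : R :=
  (2 * pi * r ^+ 2)^-1 * Num.sqrt (4 * r ^+ 2 - x ^+ 2)
  * \1_(`]- (2 * r), 2 * r[%classic) x.

Definition semicircle_law r : set (measurableTypeR R) -> \bar R :=
  fun A => (\int[lebesgue_measure]_(x in A) (semicircle_pdf r x)%:E)%E.

Lemma semicircle_pdf_ge0 r x : 0 <= semicircle_pdf r x.
Proof.
apply: mulr_ge0; last by rewrite indicE.
rewrite mulr_ge0 ?sqrtr_ge0// invr_ge0.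
by apply: mulr_ge0; [apply: mulr_ge0; [exact: ler0n|exact: pi_ge0]|exact: sqr_ge0].
Qed.

Lemma measurable_semicircle_pdf r :
  measurable_fun [set: measurableTypeR R] (semicircle_pdf r).
Proof.
apply: measurable_funM; last first.
  by apply: measurable_indic; exact: measurable_itv.
apply: measurable_funM => //.
apply: measurableT_comp.
  apply: continuous_measurable_fun; exact: sqrt_continuous.
apply: measurable_funB => //.
Qed.

Section Instance.
Variable r : R.

Let law0 : semicircle_law r set0 = 0%E.
Proof. by rewrite /semicircle_law integral_set0. Qed.

Let law_ge0 A : (0 <= semicircle_law r A)%E.
Proof. by apply: integral_ge0 => x _; rewrite lee_fin semicircle_pdf_ge0. Qed.

Let law_sigma_additive : semi_sigma_additive (semicircle_law r).
Proof.
move=> A mA tA mUA; rewrite /semicircle_law ge0_integral_bigcup//=.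
- apply: is_cvg_ereal_nneg_natsum_cond => n _ _.
  by apply: integral_ge0 => x _; rewrite lee_fin semicircle_pdf_ge0.
- apply/measurable_EFinP; apply: measurable_funTS.
  exact: measurable_semicircle_pdf.
- by move=> x _; rewrite lee_fin semicircle_pdf_ge0.
Qed.

HB.instance Definition _ := isMeasure.Build _ _ _ (semicircle_law r)
  law0 law_ge0 law_sigma_additive.

End Instance.
End Laws.

(* Main.v *)
(* Write r = |f|. Every vector of the Fock space orthogonal to all classes of
   elementary tensors vanishes, so the annihilator is known from its inner
   products with them.
   For q = -1 the class of f (x) f is null, hence X Phi = f and X f = r^2 Phi,
   and the vacuum moments are those of the two-point law.
   For q = 0 all lambda_n are identities; with e_k the class of f^{(x) k},
   X e_0 = e_1 and X e_{k+1} = e_{k+2} + r^2 e_k. Hence <Phi, X^n e_k> obeys the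
   recursion of (2/pi) int_0^pi (2r cos t)^n r^k sin((k+1)t) sin t dt, which for
   k = 0 is the n-th semi-circle moment after the substitution x = 2r cos t.
   Both laws have bounded support. A probability measure with the same moments
   has bounded support by Markov's inequality, and polynomial approximations of
   step functions show that the two distribution functions agree. *)

Require Import Defs.
From HB Require Import structures.
From mathcomp Require Import all_boot all_order all_algebra complex.
From mathcomp Require Import all_classical all_reals all_analysis.
From mathcomp Require Import ring lra measurable_realfun.
Import Order.TTheory GRing.Theory Num.Theory.
Import numFieldNormedType.Exports.
Local Open Scope classical_set_scope.
Local Open Scope ring_scope.

Set Implicit Arguments.
Unset Strict Implicit.
Unset Printing Implicit Defensive.

(** * Inner products and the Fock space *)

Section InnerTheory.
Context {R : realType} {V : hilbertType R}.
Implicit Types u v w : V.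

Lemma innerDr u v w : [< u, v + w >] = [< u, v >] + [< u, w >].
Proof. exact: linearDl. Qed.

Lemma innerZr u v a : [< u, a *: v >] = a * [< u, v >].
Proof. exact: linearZl_LR. Qed.

(** Linearity is registered so that [inner u] composes with linear maps and serves as the
    [{scalar V}] of the density lemmas. *)
HB.instance Definition _ u :=
  GRing.isLinear.Build R[i] V R[i] *%R (inner u)
    (fun a v w => etrans (innerDr u (a *: v) w)
                         (congr1 (+%R^~ _) (innerZr u v a))).

Lemma inner0r u : [< u, 0 >] = 0.
Proof. exact: linear0. Qed.

Lemma innerBr u v w : [< u, v - w >] = [< u, v >] - [< u, w >].
Proof. exact: linearB. Qed.

Lemma innerC u v : [< u, v >] = [< v, u >]^*.
Proof. by rewrite /inner hermC expr0 mul1r. Qed.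

Lemma inner_normE u : [< u, u >] = `|u| ^+ 2.
Proof. exact: hdot_norm. Qed.

Lemma inner_eq0 u : [< u, u >] = 0 -> u = 0.
Proof. by rewrite inner_normE => /eqP; rewrite sqrf_eq0 normr_eq0 => /eqP. Qed.

Lemma Cauchy_Schwarz u v : `|[< u, v >]| ^+ 2 <= `|u| ^+ 2 * `|v| ^+ 2.
Proof.
have [->|u0] := eqVneq u 0.
  by rewrite (innerC 0) inner0r conjC0 !normr0 expr0n mul0r.
have nu0 : 0 < `|u| ^+ 2 by rewrite exprn_gt0// normr_gt0.
(* [a *: u] is the orthogonal projection of [v] on the line of [u]; the remainder has nonnegative
   squared norm. *)
pose a := [< u, v >] / `|u| ^+ 2.
have : 0 <= [< v - a *: u, v - a *: u >] by rewrite inner_normE exprn_ge0.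
rewrite innerBr innerZr !(innerC (v - _)) !innerBr !innerZr.
rewrite !rmorphB !rmorphM/= -!innerC !inner_normE fmorphV/= conj_Creal ?ger0_real ?exprn_ge0//.
rewrite divfK ?gt_eqF// subrr mulr0 subr0 subr_ge0 mulrAC ler_pdivrMr//.
by rewrite normCKC -innerC mulrC [leRHS]mulrC.
Qed.

Lemma normr_inner_le u v : `|[< u, v >]| <= `|u| * `|v|.
Proof.
by rewrite -(@ler_pXn2r _ 2)// ?nnegrE ?mulr_ge0// exprMn Cauchy_Schwarz.
Qed.

End InnerTheory.

(** The bound is the one Cauchy-Schwarz gives for the seminorm <x, L x>. If phi x <> 0, a point s of
    S close to x has c |x - s| |L (x - s)| < |phi x|^2, although phi (x - s) = phi x. *)
Lemma null_on_dense (C : numFieldType) (V : normedModType C) (S : set V)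
    (phi : {scalar V}) (L : V -> V) (c : C) :
  dense S -> continuous L ->
  (forall x, `|phi x| ^+ 2 <= c * (`|x| * `|L x|)) ->
  (forall x, S x -> phi x = 0) -> forall x, phi x = 0.
Proof.
move=> dS cL phile phi0 x; apply/eqP; apply: contraT => phix.
pose h (s : V) : C^o := c * (`|x - s| * `|L (x - s)|).
have hx : h s @[s --> x] --> h x.
  apply: cvgMr; apply: cvgM.
    by apply: cvg_norm; apply: cvgB; [exact: cvg_cst|exact: cvg_id].
  apply: cvg_norm; apply: (continuous_comp (f := fun s => x - s)) => //.
    by apply: cvgB; [exact: cvg_cst|exact: cvg_id].
  exact: cL.
have e0 : 0 < `|phi x| ^+ 2 by rewrite exprn_gt0// normr_gt0.
move/cvgr_dist_lt : hx => /(_ _ e0) hx.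
have [] := dS ((fun s => `|h x - h s| < `|phi x| ^+ 2)^°).
- by exists x; exact: hx.
- exact: open_interior.
- move=> s [/interior_subset /= hs Ss].
  move: hs; rewrite {1}/h subrr normr0 mul0r mulr0 sub0r normrN.
  have := phile (x - s); rewrite linearB/= (phi0 s)// subr0 => le1.
  by rewrite ger0_norm ?(le_trans _ le1)// => /(le_lt_trans le1); rewrite ltxx.
Qed.

Lemma null_on_total (R : realType) (V : hilbertType R) (S : set V)
    (phi : {scalar V}) (L : V -> V) (c : R[i]) :
  Defs.total S -> continuous L ->
  (forall x, `|phi x| ^+ 2 <= c * (`|x| * `|L x|)) ->
  (forall x, S x -> phi x = 0) -> forall x, phi x = 0.
Proof.
move=> tS cL phile phi0; apply: (@null_on_dense _ _ _ phi L c tS) => //.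
move=> _ [k [a [s [Ss ->]]]]; rewrite linear_sum big1// => i _.
by rewrite linearZ/= phi0 ?mulr0.
Qed.

(** This is the form of tuple on which [is_lambda] prescribes lambda_{n+2}. *)
Lemma tuple_rcons2 (T : Type) n (h : (n + 2).-tuple T) :
  exists (u : n.-tuple T) x y, h = [tuple of u ++ [tuple x; y]].
Proof.
have su : size (take n h) == n by rewrite size_takel// size_tuple leq_addr.
have : size (drop n h) = 2%N by rewrite size_drop size_tuple addKn.
case E : (drop n h) => [|x [|y []]]// _.
exists (Tuple su), x, y; apply: val_inj => /=.
by rewrite -E cat_take_drop.
Qed.

Section Fock.
Context {R : realType} {H : hilbertType R} {q : R} (F : fock_space H q).
Local Notation fock_tens := (fock_tens F).

Lemma fock_tens_inner n (g h : n.-tuple H) :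
  [< fock_tens g, fock_tens h >] =
  [< tens (fock_tpow F) g, fock_lambda F n (tens (fock_tpow F) h) >].
Proof. by rewrite /Defs.fock_tens hsum_inner sep_inner. Qed.

Lemma fock_tens_ortho m n (g : m.-tuple H) (h : n.-tuple H) : m <> n ->
  [< fock_tens g, fock_tens h >] = 0.
Proof. exact: hsum_ortho. Qed.

(** Orthogonality climbs the three layers of the construction: tensor powers, separated completions,
    orthogonal sum. At each layer [inner v] is bounded as the density lemmas require. *)
Lemma fock_tens_total (v : fock_carrier F) :
  (forall n (g : n.-tuple H), [< fock_tens g, v >] = 0) -> v = 0.
Proof.
move=> v0; apply: inner_eq0.
have bound W (l : W -> fock_carrier F) (w : W) :
    `|[< v, l w >]| ^+ 2 <= `|v| ^+ 2 * [< l w, l w >].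
  by rewrite inner_normE; exact: Cauchy_Schwarz.
have part0 n (t : tpow (fock_tpow F) n) :
    [< v, hsum_in (fock_sum F) n (sep_class (fock_part F n) t) >] = 0.
  apply: (@null_on_total _ _ _
    (inner v \o hsum_in (fock_sum F) n \o sep_class (fock_part F n))
    (fock_lambda F n) (`|v| ^+ 2) (@tens_total _ _ (fock_tpow F) n)).
  - by case: (fock_lambdaP F) => + _ _ _; exact.
  - move=> x /=; apply: le_trans (bound _ _ _) _.
    rewrite hsum_inner sep_inner ler_wpM2l ?exprn_ge0//.
    (* <x, lambda x> is the squared norm of the class of x, hence equal to its modulus. *)
    rewrite -[leLHS]ger0_norm ?normr_inner_le//.
    by rewrite -(sep_inner (fock_part F n)) inner_normE exprn_ge0.
  - by move=> _ [g _ <-]; rewrite /= innerC v0 conjC0.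
have {}part0 n (x : sep_space (fock_part F n)) :
    [< v, hsum_in (fock_sum F) n x >] = 0.
  apply: (@null_on_dense _ _ _ (inner v \o hsum_in (fock_sum F) n)
    id (`|v| ^+ 2) (@sep_dense _ _ _ (fock_part F n))).
  - by move=> y; exact: cvg_id.
  - move=> y /=; apply: le_trans (bound _ _ _) _.
    by rewrite hsum_inner inner_normE expr2.
  - by move=> _ [t _ <-]; exact: part0.
apply: (@null_on_total _ _ _ (inner v) id (`|v| ^+ 2) (@hsum_total _ _ (fock_sum F))).
- by move=> y; exact: cvg_id.
- move=> y /=; apply: le_trans (bound _ id y) _.
  by rewrite /= inner_normE expr2.
- by move=> _ [n _ [x _ <-]]; exact: part0.
Qed.

Lemma vacuum_inner : [< vacuum F, vacuum F >] = 1.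
Proof.
by rewrite fock_tens_inner; case: (fock_lambdaP F) => _ -> _ _;
  rewrite tens_inner big_ord0.
Qed.

Lemma fock_tens1_inner (f g : H) :
  [< fock_tens [tuple f], fock_tens [tuple g] >] = [< f, g >].
Proof.
by rewrite fock_tens_inner; case: (fock_lambdaP F) => _ _ -> _;
  rewrite tens_inner big_ord1.
Qed.

End Fock.

Section FockN1.
Context {R : realType} {H : hilbertType R} (F : fock_space H (-1)).

(** For q = -1, lambda_2 kills f (x) f, so its class has norm zero. *)
Lemma fock_tens_sqr_eq0 (f : H) : fock_tens F [tuple f; f] = 0.
Proof.
apply: inner_eq0; rewrite fock_tens_inner.
case: (fock_lambdaP F) => _ _ _ /(_ 0%N [tuple] f f).
rewrite (_ : [tuple of _] = [tuple f; f]); last exact: val_inj.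
by move=> ->; rewrite rmorphN1 scaleN1r subrr inner0r.
Qed.

End FockN1.

Section Fock0.
Context {R : realType} {H : hilbertType R} (F : fock_space H 0).

(** Degrees 0 and 1 are separate clauses of [is_lambda]; from degree 2 on, the swapped term carries
    the factor q = 0. *)
Lemma fock_lambda_tens n (g : n.-tuple H) :
  fock_lambda F n (tens (fock_tpow F) g) = tens (fock_tpow F) g.
Proof.
case: (fock_lambdaP F) => _ lam0 lam1 lam2.
case: n g => [|[|n]] g; [exact: lam0|exact: lam1|].
move: g; rewrite -(addn2 n) => g.
have [u [x [y ->]]] := tuple_rcons2 g.
by rewrite lam2 scale0r addr0.
Qed.

Lemma fock_tens_inner0 n (g h : n.-tuple H) :
  [< fock_tens F g, fock_tens F h >] = \prod_(i < n) [< tnth g i, tnth h i >].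
Proof. by rewrite fock_tens_inner fock_lambda_tens tens_inner. Qed.

End Fock0.

Lemma hnormE (R : realType) (V : hilbertType R) (u : V) : ((hnorm u)%:C)%C = `|u|.
Proof. by rewrite RRe_real ?ger0_real. Qed.

(** * The field operator and its vacuum moments *)

Section Field.
Context {R : realType} {H : hilbertType R} {q : R} {F : fock_space H q}.
Context {f : H} {Ap Am : {linear fock_carrier F -> fock_carrier F}}.
Hypothesis creation_f : is_creation f Ap.
Hypothesis annihilation_f : is_adjoint Ap Am.
Local Notation X := (field_operator Am Ap).

(** Merges the clauses of [is_creation] for the vacuum and for positive degree, the vacuum being the
    empty tensor. *)
Lemma creationE n (g : n.-tuple H) :
  Ap (fock_tens F g) = fock_tens F [tuple of f :: g].
Proof.
case: creation_f => _ Ap0 ApS; case: n g => [|n] g; last exact: ApS.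
rewrite tuple0 -/(vacuum F) Ap0; congr (fock_tens F _); exact: val_inj.
Qed.

(** Adjointness trades [Am] for prepending [f] in inner products with elementary tensors; by
    totality these products determine [Am u]. *)
Lemma annihilationE (u v : fock_carrier F) :
  (forall n (g : n.-tuple H),
     [< fock_tens F [tuple of f :: g], u >] = [< fock_tens F g, v >]) ->
  Am u = v.
Proof.
move=> uv; apply/eqP; rewrite -subr_eq0; apply/eqP/(fock_tens_total (F := F)).
move=> n g; rewrite innerBr -annihilation_f creationE uv subrr//.
Qed.

Lemma annihilation_vacuum : Am (vacuum F) = 0.
Proof.
by apply: annihilationE => n g; rewrite inner0r fock_tens_ortho.
Qed.

Lemma field_vacuum : X (vacuum F) = fock_tens F [tuple f].
Proof.
by case: creation_f => _ Ap0 _; rewrite /field_operator annihilation_vacuum add0r.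
Qed.

Lemma annihilation1 : Am (fock_tens F [tuple f]) = (hnorm f ^+ 2)%:C%C *: vacuum F.
Proof.
apply: annihilationE => -[|n] g.
  rewrite innerZr (tuple0 g) vacuum_inner mulr1 rmorphXn/= hnormE -inner_normE.
  by rewrite -(fock_tens1_inner F); congr inner; congr (fock_tens F _); exact: val_inj.
by rewrite innerZr !fock_tens_ortho ?mulr0.
Qed.

(** [field_operator] is a bare function, so linearity of its iterates is proved directly. *)
Lemma iter_fieldD n u v : iter n X (u + v) = iter n X u + iter n X v.
Proof.
by elim: n => // n IH; rewrite !iterS IH /field_operator !linearD/= addrACA.
Qed.

Lemma iter_fieldZ n a u : iter n X (a *: u) = a *: iter n X u.
Proof.
by elim: n => // n IH; rewrite !iterS IH /field_operator !linearZ/= scalerDr.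
Qed.

Lemma field_moments_two_point : fock_tens F [tuple f; f] = 0 -> forall n,
  [< vacuum F, iter n X (vacuum F) >] =
  (2^-1 * (- hnorm f) ^+ n + 2^-1 * hnorm f ^+ n)%:C%C.
Proof.
move=> ff0.
have XX : X (fock_tens F [tuple f]) = (hnorm f ^+ 2)%:C%C *: vacuum F.
  rewrite /field_operator annihilation1 creationE.
  by rewrite (_ : [tuple of _] = [tuple f; f]) ?ff0 ?addr0//; exact: val_inj.
(* Since X^2 Phi = r^2 Phi, the recursion advances by two, and consecutive moments are proved
   together. *)
suff : forall n,
  [< vacuum F, iter n X (vacuum F) >] =
    (2^-1 * (- hnorm f) ^+ n + 2^-1 * hnorm f ^+ n)%:C%C /\
  [< vacuum F, iter n.+1 X (vacuum F) >] =
    (2^-1 * (- hnorm f) ^+ n.+1 + 2^-1 * hnorm f ^+ n.+1)%:C%C.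
  by move=> h n; case: (h n).
elim=> [|n [IH0 IH1]]; split => //.
- by rewrite /= vacuum_inner !expr0 -mulrDr mulVf ?pnatr_eq0.
- by rewrite /= field_vacuum fock_tens_ortho// !expr1 mulrN addNr.
- rewrite !iterSr field_vacuum XX iter_fieldZ innerZr IH0 -rmorphM/=.
  by congr (_%:C)%C; rewrite !exprS; ring.
Qed.

End Field.

Section Field0.
Context {R : realType} {H : hilbertType R} {F : fock_space H 0}.
Context {f : H} {Ap Am : {linear fock_carrier F -> fock_carrier F}}.
Hypothesis creation_f : is_creation f Ap.
Hypothesis annihilation_f : is_adjoint Ap Am.
Local Notation X := (field_operator Am Ap).
Local Notation e n := (fock_tens F [tuple of nseq n f]).

Lemma field_tensX n : X (e n.+1) = e n.+2 + (hnorm f ^+ 2)%:C%C *: e n.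
Proof.
rewrite addrC /field_operator; congr (_ + _); last first.
  rewrite (creationE creation_f); congr (fock_tens F _); exact: val_inj.
apply: (annihilationE creation_f annihilation_f) => m g; rewrite innerZr.
(* In degree m <> n both sides vanish; in degree n the factor of index 0 is <f, f> = r^2 and the
   others agree. *)
have [mn|/eqP mn] := eqVneq m n; last first.
  by rewrite !fock_tens_ortho ?mulr0// => -[].
subst m; rewrite !fock_tens_inner0 big_ord_recl/= !(tnth_nth f)/=.
rewrite rmorphXn/= hnormE -inner_normE; congr (_ * _).
by apply: eq_bigr => i _; rewrite !(tnth_nth f)/= nth_nseq !if_same.
Qed.

(** [J] is any solution of the recursion of <Phi, X^n e_k>. It counts n-step paths from height k to
    0 that stay nonnegative, each down step weighted by r^2, as ballot numbers do. *)
Lemma field_moments_ballot (J : nat -> nat -> R) :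
  (forall k, J 0 k = (k == 0)%:R) ->
  (forall n, J n.+1 0 = J n 1) ->
  (forall n k, J n.+1 k.+1 = J n k.+2 + hnorm f ^+ 2 * J n k) ->
  forall n k, [< vacuum F, iter n X (e k) >] = (J n k)%:C%C.
Proof.
move=> J0 Jn0 JnS.
have e0 : e 0 = vacuum F by congr (fock_tens F _); exact: val_inj.
have e1 : e 1 = fock_tens F [tuple f] by congr (fock_tens F _); exact: val_inj.
elim=> [|n IH] [|k].
- by rewrite /= e0 vacuum_inner J0.
- by rewrite /= fock_tens_ortho// J0.
- by rewrite iterSr e0 (field_vacuum creation_f)// -e1 IH Jn0.
- rewrite iterSr field_tensX iter_fieldD iter_fieldZ innerDr innerZr !IH JnS.
  by rewrite -rmorphM -rmorphD.
Qed.

End Field0.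

(** * Measures determined by their moments *)

Section StepPolynomial.
Context {R : realType}.

Lemma exprn_lt_eps (z e : R) : 0 <= z < 1 -> 0 < e ->
  exists n, forall m, (n <= m)%N -> z ^+ m < e.
Proof.
move=> /andP[z0 z1] e0.
have /cvgrPdist_lt/(_ _ e0)[n _ nP] : GRing.exp z @ \oo --> (0 : R).
  by apply: cvg_expr; rewrite ger0_norm.
exists n => m nm; have := nP m nm; rewrite sub0r normrN; apply: le_lt_trans.
exact: ler_norm.
Qed.

Lemma bernoulli_ineq (u : R) n : 0 <= u <= 1 -> 1 - n%:R * u <= (1 - u) ^+ n.
Proof.
move=> /andP[u0 u1]; elim: n => [|n IH]; first by rewrite mul0r subr0.
rewrite exprSr (le_trans _ (ler_wpM2r _ IH)) ?subr_ge0//.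
rewrite -natr1; have : 0 <= n%:R * u ^+ 2 by rewrite mulr_ge0 ?sqr_ge0.
by rewrite expr2; lra.
Qed.

Lemma bernoulli_ineqD (u : R) n : 0 <= u -> 1 + n%:R * u <= (1 + u) ^+ n.
Proof.
move=> u0; elim: n => [|n IH]; first by rewrite mul0r addr0.
rewrite exprSr (le_trans _ (ler_wpM2r _ IH)) ?addr_ge0//.
rewrite -natr1; have : 0 <= n%:R * u ^+ 2 by rewrite mulr_ge0 ?sqr_ge0.
by rewrite expr2; lra.
Qed.

(** Bernoulli replaces 1 + n u by (1 + u)^n, and (1 - u)(1 + u) <= 1. Thus (1 - u)^n is small once n
    u is large. *)
Lemma expr_1B_le (u : R) n : 0 <= u <= 1 -> (1 - u) ^+ n * (1 + n%:R * u) <= 1.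
Proof.
move=> /andP[u0 u1]; have u1' : 0 <= 1 - u by rewrite subr_ge0.
have u2 : 0 <= 1 + u by rewrite addr_ge0.
apply: (le_trans (ler_wpM2l _ (bernoulli_ineqD n u0))); first exact: exprn_ge0.
rewrite -exprMn exprn_ile1 ?mulr_ge0//.
by have := sqr_ge0 u; rewrite expr2; lra.
Qed.

(* The polynomials (1 - y^(mn))^(k^n) of the elementary proof of the
   Stone-Weierstrass theorem, with k a^m < 1 < k b^m. *)
Lemma step_polynomial01 (a b e : R) : 0 < a -> a < b -> 0 < e ->
  exists p : {poly R}, forall y, 0 <= y <= 1 ->
    [/\ 0 <= p.[y] <= 1, y <= a -> 1 - e <= p.[y] & b <= y -> p.[y] <= e].
Proof.
move=> a0 ab e0; have [b1|b1] := ltP 1 b.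
  (* No y of [0, 1] lies beyond b > 1, so a constant will do. *)
  exists 1 => y /andP[y0 y1]; rewrite hornerC ler01 lexx; split => // [_|].
    by rewrite gerBl ltW.
  by move=> /(lt_le_trans b1)/lt_le_trans/(_ y1); rewrite ltxx.
have b0 := lt_trans a0 ab.
(* Once (a / b)^m < 1/2, the integer k just above b^-m has k b^m > 1, while k <= 2 b^-m gives k a^m
   < 1. *)
have [m /(_ _ (leqnn m)) ltm] : exists m, forall k, (m <= k)%N -> (a / b) ^+ k < 2^-1.
  apply: exprn_lt_eps; last by rewrite invr_gt0.
  by rewrite divr_ge0 ?ltW//= ltr_pdivrMr// mul1r.
have bm0 : 0 < b ^+ m by rewrite exprn_gt0.
have bm1 : 1 <= (b ^+ m)^-1 by rewrite invf_ge1// exprn_ile1// ltW.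
pose k := (Num.truncn (b ^+ m)^-1).+1.
have kb : 1 < k%:R * b ^+ m.
  by rewrite -ltr_pdivrMr// mul1r; exact: truncnS_gt.
have ka : k%:R * a ^+ m < 1.
  have k2 : k%:R <= 2 * (b ^+ m)^-1.
    have /andP[tle _] := truncn_itv (le_trans ler01 bm1).
    by rewrite /k -(natr1 (Num.truncn _)); lra.
  apply: (le_lt_trans (ler_wpM2r _ k2)); first by rewrite exprn_ge0 ?ltW.
  rewrite -mulrA [_^-1 * _]mulrC -exprVn -exprMn.
  by rewrite -ltr_pdivlMl// mulr1.
have [n1 n1P] : exists n, forall l, (n <= l)%N -> (k%:R * a ^+ m) ^+ l < e.
  by apply: exprn_lt_eps => //; rewrite ka mulr_ge0 ?exprn_ge0 ?ltW.
have [n2 n2P] : exists n, forall l, (n <= l)%N -> ((k%:R * b ^+ m)^-1) ^+ l < e.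
  apply: exprn_lt_eps => //; rewrite invf_lt1 ?kb ?andbT//.
    by rewrite invr_ge0 ltW// (lt_trans ltr01).
  exact: lt_trans kb.
pose n := maxn n1 n2.
(* Bernoulli bounds the value below by 1 - (k a^m)^n when y <= a; [expr_1B_le] bounds it above by (k
   b^m)^-n when b <= y. *)
exists ((1 - 'X^(m * n)) ^+ (k ^ n)) => y /andP[y0 y1].
rewrite !hornerE.
have u0 : 0 <= y ^+ (m * n) by rewrite exprn_ge0.
have u1 : y ^+ (m * n) <= 1 by rewrite exprn_ile1.
have u01 : 0 <= y ^+ (m * n) <= 1 by rewrite u0.
split.
- by rewrite exprn_ge0 ?subr_ge0//= exprn_ile1 ?subr_ge0// gerBl.
- move=> ya; apply: le_trans (bernoulli_ineq _ u01).
  rewrite lerB// natrX exprM -exprMn; apply: ltW; apply: le_lt_trans (n1P n _).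
    by rewrite lerXn2r ?nnegrE ?mulr_ge0 ?exprn_ge0 ?(ltW a0)// ler_wpM2l// lerXn2r ?nnegrE ?(ltW a0).
  exact: leq_maxl.
- move=> yb; have := expr_1B_le (k ^ n) u01.
  have d0 : 0 < (k%:R * b ^+ m) ^+ n by rewrite exprn_gt0// (lt_trans ltr01).
  have dle : (k%:R * b ^+ m) ^+ n <= 1 + (k ^ n)%:R * y ^+ (m * n).
    rewrite natrX exprM -exprMn.
    apply: le_trans (_ : (k%:R * y ^+ m) ^+ n <= _); last by rewrite lerDr.
    by rewrite lerXn2r ?nnegrE ?mulr_ge0 ?exprn_ge0 ?(ltW b0)// ler_wpM2l// lerXn2r ?nnegrE ?(ltW b0).
  move=> le1; apply: ltW; apply: le_lt_trans (n2P n (leq_maxr _ _)).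
  rewrite exprVn -[_^-1]mul1r ler_pdivlMr//.
  by apply: le_trans le1; rewrite ler_wpM2l ?exprn_ge0 ?subr_ge0.
Qed.

(** The map x -> (x + 2K) / (3K) sends [-K, K] to [1/3, 1], so the image of a >= -K is positive, as
    [step_polynomial01] requires. For a < -K the zero polynomial suffices. *)
Lemma step_polynomial (K a b e : R) : 0 < K -> a < b -> 0 < e ->
  exists p : {poly R}, forall x, - K <= x <= K ->
    [/\ 0 <= p.[x] <= 1, x <= a -> 1 - e <= p.[x] & b <= x -> p.[x] <= e].
Proof.
move=> K0 ab e0; have [aK|aK] := ltP a (- K).
  exists 0 => x /andP[x0 _]; rewrite horner0 lexx ler01; split => // [xa|_].
    by have := lt_le_trans (le_lt_trans xa aK) x0; rewrite ltxx.
  exact: ltW.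
have K3 : 0 < 3 * K by rewrite mulr_gt0.
have [|||p pP] := @step_polynomial01 ((a + 2 * K) / (3 * K)) ((b + 2 * K) / (3 * K)) e.
- by rewrite divr_gt0//; lra.
- by rewrite ltr_pM2r ?invr_gt0//; lra.
- exact: e0.
exists (p \Po ((3 * K)^-1 *: ('X + (2 * K)%:P))) => x /andP[x0 x1].
rewrite horner_comp !hornerE mulrC.
have [|p01 pa pb] := pP ((x + 2 * K) / (3 * K)).
  by rewrite divr_ge0 ?ler_pdivrMr ?(ltW K3)//; lra.
split => //.
- by move=> xa; apply: pa; rewrite ler_pM2r ?invr_gt0//; lra.
- by move=> xb; apply: pb; rewrite ler_pM2r ?invr_gt0//; lra.
Qed.

End StepPolynomial.

(** * Polynomials and measures of bounded support *)

Section BoundedSupport.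
Context {R : realType} (mu : {measure set (measurableTypeR R) -> \bar R}).
Hypothesis mu1 : mu setT = 1%E.
Variable K : R.
Hypothesis muK : mu (~` `[- K, K]) = 0%E.

Let mK : measurable (`[- K, K] : set (measurableTypeR R)).
Proof. exact: measurable_itv. Qed.

Lemma integrable_pow_bounded_support n :
  mu.-integrable setT (fun x : R => (x ^+ n)%:E).
Proof.
have mpow : measurable_fun setT (fun x : measurableTypeR R => x ^+ n).
  exact: exprn_measurable.
apply/(@negligible_integrable _ _ _ mu setT (~` `[- K, K])) => //.
- exact: measurableC.
- exact/measurable_EFinP.
rewrite setTD setCK; apply: measurable_bounded_integrable => //.
- by apply: le_lt_trans (_ : mu setT < +oo)%E; rewrite ?le_measure ?inE// mu1 ltry.
exists (K ^+ n); split; first exact: num_real.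
move=> M KM x /=; rewrite in_itv/= => xK; rewrite normrX (le_trans _ (ltW KM))//.
by rewrite lerXn2r ?nnegrE// ?ler_norml//; apply: le_trans (_ : `|x| <= K); rewrite ?ler_norml.
Qed.

Lemma Rintegral_pow_bounded_support n :
  \int[mu]_x (x ^+ n) = \int[mu]_(x in `[- K, K]) (x ^+ n).
Proof.
rewrite /Rintegral (@negligible_integral _ _ _ mu setT (~` `[- K, K]))//.
- by rewrite setTD setCK.
- exact: measurableC.
- exact: integrable_pow_bounded_support.
Qed.

Let intx D n : measurable (D : set (measurableTypeR R)) ->
  mu.-integrable D (fun x : R => (x ^+ n)%:E).
Proof. by move=> mD; apply: integrableS (integrable_pow_bounded_support n). Qed.

(** Coefficients and length are free because the induction in [Rintegral_horner] meets truncations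
    of the polynomial. *)
Let integrable_monomials (D : set (measurableTypeR R)) (c : nat -> R) k : measurable D ->
  mu.-integrable D (fun x : R => (\sum_(i < k) c i * x ^+ i)%:E).
Proof.
move=> mD.
rewrite (_ : (fun _ => _) = (fun x => \sum_(i < k) (c i)%:E * (x ^+ i)%:E)%E).
  by apply: integrable_sum => // i _; apply: integrableZl => //; exact: intx.
by apply/funext => x /=; rewrite -sumEFin.
Qed.

Lemma integrable_horner (D : set (measurableTypeR R)) (p : {poly R}) : measurable D ->
  mu.-integrable D (fun x : R => (p.[x])%:E).
Proof.
move=> mD; under eq_fun do rewrite horner_coef; exact: integrable_monomials.
Qed.

Lemma Rintegral_horner (D : set (measurableTypeR R)) (p : {poly R}) : measurable D ->
  \int[mu]_(x in D) p.[x] = \sum_(i < size p) p`_i * \int[mu]_(x in D) (x ^+ i).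
Proof.
move=> mD; under eq_Rintegral do rewrite horner_coef.
elim: (size p) => [|k IH].
  rewrite big_ord0; under eq_Rintegral do rewrite big_ord0.
  by rewrite Rintegral_cst// mul0r.
rewrite big_ord_recr/= -IH; under [LHS]eq_Rintegral do rewrite big_ord_recr/=.
rewrite RintegralD//.
- by rewrite RintegralZl//; exact: intx.
- exact: integrable_monomials.
- rewrite (_ : _ \o _ = (fun x => (p`_k)%:E * (x ^+ k)%:E)%E)//.
  by apply: integrableZl => //; exact: intx.
Qed.

Lemma measure_bounded_support (A : set (measurableTypeR R)) : measurable A ->
  mu A = mu (A `&` `[- K, K]).
Proof.
move=> mA; have mKC := measurableC mK.
rewrite (@measureDI _ _ _ mu _ _ mA mK) [X in (X + _)%E](_ : _ = 0%E) ?add0e//.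
apply: subset_measure0 muK; [exact: measurableD|exact: measurableC|by move=> x []].
Qed.

End BoundedSupport.

(* Markov's inequality for x^(2n), with n tending to infinity. *)
Lemma support_of_moments (R : realType) (nu : probability (measurableTypeR R) R)
    (K L : R) : 0 <= K -> K < L ->
  (forall n, nu.-integrable setT (fun x : R => (x ^+ n)%:E)) ->
  (forall n, \int[nu]_x (x ^+ (2 * n)) <= K ^+ (2 * n)) ->
  nu (~` `[- L, L]) = 0%E.
Proof.
move=> K0 KL intx nuK; set A := ~` _; have L0 : 0 < L := le_lt_trans K0 KL.
have mA : measurable (A : set (measurableTypeR R)).
  by apply: measurableC; exact: measurable_itv.
(* L^(2n) nu(A) <= int_A x^(2n) <= K^(2n); the even exponent keeps the integrand nonnegative. *)
have nuA n : (nu A <= ((K / L) ^+ (2 * n))%:E)%E.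
  have Ln0 : 0 < L ^+ (2 * n) by rewrite exprn_gt0.
  rewrite exprMn exprVn mulrC EFinM lee_pdivlMl//.
  apply: (@le_trans _ _ (\int[nu]_x (x ^+ (2 * n)))%:E); last by rewrite lee_fin.
  rewrite /Rintegral fineK; last exact: integrable_fin_num.
  rewrite -integral_cst//.
  have x2n0 (x : R) : 0 <= x ^+ (2 * n) by rewrite exprM exprn_ge0// sqr_ge0.
  apply: (@le_trans _ _ (\int[nu]_(x in A) (x ^+ (2 * n))%:E)%E).
    apply: ge0_le_integral => //.
    - by move=> x _; rewrite lee_fin ltW.
    - apply/measurable_EFinP; apply: measurable_funTS; exact: exprn_measurable.
    move=> x; rewrite /A/= in_itv/= => /negP; rewrite -ler_norml -ltNge => Lx.
    rewrite lee_fin -[x ^+ _]ger0_norm// normrX lerXn2r ?nnegrE ?(ltW L0)//.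
    exact: ltW.
  apply: ge0_subset_integral => //.
  - by apply/measurable_EFinP; exact: exprn_measurable.
  - by move=> x _; rewrite lee_fin.
apply/eqP; rewrite eq_le measure_ge0 andbT; apply/lee_addgt0Pr => e e0.
rewrite add0e; have [n nP] : exists n, forall m, (n <= m)%N -> (K / L) ^+ m < e.
  by apply: exprn_lt_eps => //; rewrite divr_ge0 ?(ltW L0)//= ltr_pdivrMr// mul1r.
by apply: le_trans (nuA n) _; rewrite lee_fin ltW// nP// leq_pmull.
Qed.

(** A polynomial p near 1 left of a and near 0 right of b has the same integral under both measures,
    whence (1 - e) mu(]-oo, a]) <= int p <= nu(]-oo, b[) + e. The gap a < b leaves p room to
    descend. *)
Lemma moments_cdf_le (R : realType) (mu nu : {measure set (measurableTypeR R) -> \bar R})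
    (K a b : R) : 0 < K -> a < b ->
  mu setT = 1%E -> nu setT = 1%E ->
  mu (~` `[- K, K]) = 0%E -> nu (~` `[- K, K]) = 0%E ->
  (forall n, \int[mu]_x (x ^+ n) = \int[nu]_x (x ^+ n)) ->
  (mu `]-oo, a]%classic <= nu `]-oo, b[%classic)%E.
Proof.
move=> K0 ab mu1 nu1 muK nuK mom.
have mK : measurable (`[- K, K]%classic : set (measurableTypeR R)).
  exact: measurable_itv.
have mA : measurable (`]-oo, a]%classic : set (measurableTypeR R)).
  exact: measurable_itv.
have mB : measurable (`]-oo, b[%classic : set (measurableTypeR R)).
  exact: measurable_itv.
have muA1 : (mu `]-oo, a]%classic <= 1)%E by rewrite -mu1 le_measure ?inE.
have nuB1 : (nu `]-oo, b[%classic <= 1)%E by rewrite -nu1 le_measure ?inE.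
have fmuA : mu `]-oo, a]%classic \is a fin_num.
  by rewrite ge0_fin_numE// (le_lt_trans muA1) ?ltry.
have fnuB : nu `]-oo, b[%classic \is a fin_num.
  by rewrite ge0_fin_numE// (le_lt_trans nuB1) ?ltry.
have key (e : R) : 0 < e < 1 ->
    (1 - e) * fine (mu `]-oo, a]%classic) <= fine (nu `]-oo, b[%classic) + e.
  move=> /andP[e0 e1]; have [p pP] := step_polynomial K0 ab e0.
  have mp D : measurable_fun (D : set (measurableTypeR R)) (fun x : measurableTypeR R => (p.[x])%:E).
    apply/measurable_EFinP; apply: measurable_funTS; apply: continuous_measurable_fun.
    by move=> x; exact: continuous_horner.
  have mi S D : measurable S ->
      measurable_fun (D : set (measurableTypeR R)) (fun x => (\1_S x)%:E : \bar R).
    by move=> mS; apply/measurable_EFinP; exact: measurable_indic.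
  have peq : (\int[mu]_(x in `[(- K)%R, K]) (p.[x])%:E =
              \int[nu]_(x in `[(- K)%R, K]) (p.[x])%:E)%E.
    rewrite -[LHS]fineK; last first.
      by apply: integrable_fin_num => //; exact: (integrable_horner mu1 muK).
    rewrite -[RHS]fineK; last first.
      by apply: integrable_fin_num => //; exact: (integrable_horner nu1 nuK).
    congr EFin; rewrite -2!/(Rintegral _ _ _).
    rewrite (Rintegral_horner mu1 muK)// (Rintegral_horner nu1 nuK)//.
    apply: eq_bigr => i _; rewrite -(Rintegral_pow_bounded_support mu1 muK).
    by rewrite -(Rintegral_pow_bounded_support nu1 nuK) mom.
  rewrite -lee_fin EFinM [in leRHS]EFinD !fineK//.
  rewrite (measure_bounded_support muK mA).
  apply: (@le_trans _ _ (\int[mu]_(x in `[(- K)%R, K]) (p.[x])%:E)%E).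
    rewrite -integral_indic// -ge0_integralZl//; last 2 first.
    - exact: mi.
    - by rewrite lee_fin subr_ge0 ltW.
    apply: ge0_le_integral => //.
    - by move=> x _; rewrite mule_ge0 ?lee_fin// subr_ge0 ltW.
    - by apply: emeasurable_funM => //; exact: mi.
    move=> x /=; rewrite in_itv/= => xK; have [/andP[p0 _] pa _] := pP x xK.
    rewrite -EFinM lee_fin indicE; case: (boolP (x \in _)) => xa.
      by rewrite mulr1 pa//; move: xa; rewrite inE/= in_itv.
    by rewrite mulr0.
  rewrite peq; apply: (@le_trans _ _
      (\int[nu]_(x in `[(- K)%R, K]) ((\1_`]-oo, b[%classic x)%:E + e%:E))%E).
    apply: ge0_le_integral => //.
    - by move=> x /=; rewrite in_itv/= => xK; have [/andP[p0 _] _ _] := pP x xK.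
    - by apply: emeasurable_funD => //; exact: mi.
    move=> x /=; rewrite in_itv/= => xK; have [/andP[p0 p1] _ pb] := pP x xK.
    rewrite -EFinD lee_fin indicE; case: (boolP (x \in _)) => xa.
      by rewrite (le_trans p1)// lerDl ltW.
    by rewrite add0r pb// leNgt; apply: contra xa; rewrite inE/= in_itv.
  rewrite ge0_integralD//; last 2 first.
  - exact: mi.
  - by move=> x _; rewrite lee_fin ltW.
  rewrite integral_indic// integral_cst// leeD//.
    by rewrite le_measure ?inE//; exact: measurableI.
  rewrite -[leRHS]mule1 lee_wpmul2l ?lee_fin ?(ltW e0)// -nu1 le_measure ?inE//.
rewrite -(fineK fmuA) -(fineK fnuB) lee_fin leNgt; apply/negP => lt_nu_mu.
have x1 : fine (mu `]-oo, a]%classic) <= 1 by rewrite -lee_fin fineK.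
have y0 : 0 <= fine (nu `]-oo, b[%classic) by rewrite fine_ge0.
set x := fine (mu _) in lt_nu_mu x1 key; set y := fine (nu _) in lt_nu_mu y0 key.
(* As x <= 1, [key] would give x - y <= e (1 + x) <= 2 e, against x - y = 3 e. *)
have e01 : 0 < (x - y) / 3 < 1 by apply/andP; split; lra.
have := key _ e01; nra.
Qed.

(** Continuity from below along ]-oo, x - 1/(k+1)]; it closes the gap left by [moments_cdf_le]. *)
Lemma measure_itvNyo_le (R : realType) (m : {measure set (measurableTypeR R) -> \bar R})
    (x : R) (c : \bar R) :
  (forall a : R, a < x -> (m `]-oo, a]%classic <= c)%E) -> (m `]-oo, x[%classic <= c)%E.
Proof.
move=> mc; pose F (k : nat) : set (measurableTypeR R) := `]-oo, (x - k.+1%:R^-1)]%classic.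
have -> : `]-oo, x[%classic = \bigcup_k F k.
  rewrite eqEsubset; split => y /=; rewrite /F /= in_itv/=.
    rewrite -subr_gt0 => xy; pose k := Num.truncn (x - y)^-1.
    exists k => //=; rewrite in_itv/= lerBrDl -lerBrDr.
    by rewrite invf_ple ?posrE ?ltr0n// ltW// truncnS_gt.
  move=> [k _]/=; rewrite in_itv/= => /le_lt_trans; apply.
  by rewrite gtrBl invr_gt0 ltr0n.
have mF k : measurable (F k) by exact: measurable_itv.
have ndF : nondecreasing_seq F.
  move=> i j ij; apply/subsetPset; apply: subset_itvl.
  by rewrite bnd_simp lerB// lef_pV2 ?posrE ?ltr0n// ler_nat.
have cvF := @nondecreasing_cvg_mu _ _ _ m F mF (bigcupT_measurable _ mF) ndF.
rewrite -(cvg_lim _ cvF)//; apply: lime_le.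
  by apply/cvg_ex; eexists; exact: cvF.
by apply: nearW => k; apply: mc; rewrite gtrBl invr_gt0 ltr0n.
Qed.

(** Open half-lines are stable under intersection, generate the Borel sets and exhaust the line. On
    them [moments_cdf_le] is applied in both directions. *)
Lemma moments_unique (R : realType) (mu nu : {measure set (measurableTypeR R) -> \bar R})
    (K : R) : 0 < K ->
  mu setT = 1%E -> nu setT = 1%E ->
  mu (~` `[- K, K]) = 0%E -> nu (~` `[- K, K]) = 0%E ->
  (forall n, \int[mu]_x (x ^+ n) = \int[nu]_x (x ^+ n)) ->
  forall A, measurable A -> mu A = nu A.
Proof.
move=> K0 mu1 nu1 muK nuK mom A; rewrite RGenInftyO.measurableE => mA.
apply: (@g_sigma_algebra_measure_unique _ R (measurableTypeR R) (@RGenInftyO.G R) _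
  (fun n => `]-oo, n%:R[%classic) _ _ mu nu _ _ _ A mA).
- by move=> _ [x ->]; exact: measurable_itv.
- by move=> n; exists n%:R.
- rewrite -subTset => x _; exists (Num.truncn x).+1 => //=.
  by rewrite in_itv/= truncnS_gt.
- move=> _ _ [x ->] [y ->]; exists (Num.min x y).
  by rewrite eqEsubset; split => z /=; rewrite !in_itv/= lt_min => /andP.
- move=> _ [x ->]; apply/eqP; rewrite eq_le; apply/andP; split.
    by apply: measure_itvNyo_le => a ax; exact: (@moments_cdf_le _ _ _ K).
  apply: measure_itvNyo_le => a ax; apply: (@moments_cdf_le _ _ _ K) => //.
- move=> n; apply: (@le_lt_trans _ _ (mu setT)); last by rewrite mu1 ltry.
  by rewrite le_measure ?inE//; exact: measurable_itv.
Qed.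

(** * Semi-circle law *)

Section Semicircle.
Context {R : realType}.
Local Notation mu := (@lebesgue_measure R).

Lemma derivable_FTC2 (f F : R -> R) (a b : R) : a < b ->
  continuous f -> (forall x : R, is_derive x 1 F (f x)) ->
  \int[mu]_(x in `[a, b]) f x = F b - F a.
Proof.
move=> ab cf dF.
have cF : continuous F.
  by move=> x; apply/differentiable_continuous/derivable1_diffP; case: (dF x).
rewrite /Rintegral (@continuous_FTC2 _ f F)//.
- exact: continuous_subspaceT.
- split.
  + by move=> x _; case: (dF x).
  + by apply: cvg_at_right_filter; exact: cF.
  + by apply: cvg_at_left_filter; exact: cF.
- by move=> x _; rewrite derive1E derive_val.
Qed.

Lemma is_derive_sinM (c x : R) :
  is_derive x 1 (fun t => sin (c * t)) (c * cos (c * x)).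
Proof.
have dM : is_derive x 1 ( *%R c) c.
  by apply: is_derive_eq; rewrite /GRing.scale/= mulr1.
by rewrite mulrC; exact: (@is_derive1_comp _ sin ( *%R c) x (cos (c * x)) c).
Qed.

Lemma sinMpi n : sin (n%:R * pi) = 0 :> R.
Proof.
elim: n => [|n IH]; first by rewrite mul0r sin0.
by rewrite -natr1 mulrDl mul1r sinDpi IH oppr0.
Qed.

Lemma continuous_sinM (c : R) : continuous (fun t => sin (c * t)).
Proof.
move=> x; apply: (continuous_comp (f := fun t => c * t)).
  by apply: cvgMr; exact: cvg_id.
exact: continuous_sin.
Qed.

Lemma integral_sinM_sin k :
  \int[mu]_(t in `[0, pi]) (sin (k.+1%:R * t) * sin t) = (pi / 2) *+ (k == 0%N).
Proof.
have cS : continuous (fun t : R => sin (k.+1%:R * t) * sin t).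
  by move=> x; apply: cvgM; [exact: continuous_sinM|exact: continuous_sin].
case: k cS => [|k] cS /=.
  (* Frequency 1 is apart: sin^2 t has mean 1/2, and only the linear term of the antiderivative
     survives at pi. *)
  pose F (t : R) := 2^-1 * t - 4^-1 * sin (2 * t).
  have dF (x : R) : is_derive x 1 F (sin (1 * x) * sin x).
    have dS := is_derive_sinM 2 x.
    apply: is_derive_eq; rewrite /GRing.scale/= mul1r (mulr_natl x) cos_mulr2n cos2sin2.
    by lra.
  rewrite (derivable_FTC2 (pi_gt0 R) cS dF) /F.
  by rewrite !mulr0 sin0 sinMpi mulr1n; lra.
(* From sin((k+2)t) sin t = (cos((k+1)t) - cos((k+3)t)) / 2; both sines vanish at 0 and pi. *)
pose F (t : R) := (2 * k.+1%:R)^-1 * sin (k.+1%:R * t)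
                - (2 * k.+3%:R)^-1 * sin (k.+3%:R * t).
have dF (x : R) : is_derive x 1 F (sin (k.+2%:R * x) * sin x).
  have dS1 := is_derive_sinM k.+1%:R x.
  have dS3 := is_derive_sinM k.+3%:R x.
  apply: is_derive_eq; rewrite /GRing.scale/=.
  rewrite (_ : k.+3%:R * x = k.+2%:R * x + x); last by rewrite -(natr1 k.+2); ring.
  rewrite (_ : k.+1%:R * x = k.+2%:R * x - x); last by rewrite -(natr1 k.+1); ring.
  rewrite cosB cosD; field.
  by rewrite -(natrD _ 3 k) -(natrD _ 1 k) !pnatr_eq0.
rewrite (derivable_FTC2 (pi_gt0 R) cS dF) /F.
by rewrite !sinMpi !mulr0 sin0 !mulr0 !subrr.
Qed.

(** [Num.sqrt] takes the default value 0 at negative reals. *)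
Lemma semicircle_sqrt_eq0 (r x : R) : 0 < r -> x \notin `]- (2 * r), 2 * r[ ->
  Num.sqrt (4 * r ^+ 2 - x ^+ 2) = 0.
Proof.
move=> r0; rewrite in_itv/= negb_and -!leNgt => xr; apply: ler0_sqrtr.
rewrite subr_le0 (_ : 4 * r ^+ 2 = (2 * r) ^+ 2); last by rewrite exprMn; ring.
rewrite -(real_normK (num_real x)) ler_pXn2r ?nnegrE ?mulr_ge0 ?(ltW r0)//.
by rewrite ler_normr; case/orP: xr => xr; apply/orP; [right; rewrite lerNr|left].
Qed.

(* The square root already vanishes off the support. *)
Lemma semicircle_pdfE (r x : R) : 0 < r ->
  semicircle_pdf r x = (2 * pi * r ^+ 2)^-1 * Num.sqrt (4 * r ^+ 2 - x ^+ 2).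
Proof.
move=> r0; rewrite /semicircle_pdf indicE mem_setE.
by case: (boolP (x \in _)) => xr; rewrite ?mulr1// semicircle_sqrt_eq0// !mulr0.
Qed.

(** Substitution x = 2 r cos t, decreasing on [0, pi]: the root and the Jacobian both become 2 r sin
    t, and the constant turns their product into (2 / pi) sin^2 t. *)
Lemma integral_semicircle_cos (r : R) (p : R -> R) : 0 < r -> continuous p ->
  (\int[mu]_x (p x * semicircle_pdf r x)%:E =
   \int[mu]_(t in `[0%R, pi]) (p (2 * r * cos t) * (2 / pi * sin t ^+ 2))%:E)%E.
Proof.
move=> r0 cp.
(* Without the indicator the integrand is continuous up to the end points, as the substitution
   asks. *)
pose G x := p x * ((2 * pi * r ^+ 2)^-1 * Num.sqrt (4 * r ^+ 2 - x ^+ 2)).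
pose F t : R := 2 * r * cos t.
have F0 : F 0 = 2 * r by rewrite /F cos0 mulr1.
have Fpi : F pi = - (2 * r) by rewrite /F cospi mulrN1.
have dF (t : R) : is_derive t 1 F (- (2 * r * sin t)).
  by apply: is_derive_eq; rewrite /GRing.scale/= mulrN.
have cF : continuous F.
  by move=> x; apply/differentiable_continuous/derivable1_diffP; case: (dF x).
have dFE : (F^`())%classic = fun t => - (2 * r * sin t).
  by apply/funext => t; rewrite derive1E derive_val.
have cdF : continuous (F^`())%classic.
  rewrite dFE => t; apply: cvgN; apply: cvgMr; exact: continuous_sin.
have cG : continuous G.
  move=> x; apply: cvgM; first exact: cp.
  apply: cvgMr; apply: (continuous_comp (f := fun x : R => 4 * r ^+ 2 - x ^+ 2)).
    by apply: cvgB; [exact: cvg_cst|exact: exprn_continuous].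
  exact: sqrt_continuous.
transitivity (\int[mu]_(x in `[F pi, F 0%R]) (G x)%:E)%E; last first.
  rewrite integration_by_substitution_decreasing ?pi_ge0//.
  - apply: eq_integral => t /[!inE]/=; rewrite in_itv/= => tpi.
    congr EFin; rewrite /G /= !fctE dFE opprK -(mulrA (p _)); congr (_ * _).
    rewrite (_ : _ - _ = (2 * r * sin t) ^+ 2).
      rewrite sqrtr_sqr ger0_norm ?mulr_ge0 ?sin_ge0_pi ?(ltW r0)//.
      by move: (pi_gt0 R); move: (pi : R) => P P0; field; rewrite !gt_eqF.
    by rewrite /F !exprMn cos2sin2; ring.
  - move=> x y xpi ypi xy; rewrite /F ltr_pM2l ?mulr_gt0//.
    by rewrite ltr_cos.
  - by apply/cvg_ex; exists ((F^`())%classic 0); apply: cvg_at_right_filter; exact: cdF.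
  - by apply/cvg_ex; exists ((F^`())%classic pi); apply: cvg_at_left_filter; exact: cdF.
  - split.
    + by move=> x _; case: (dF x).
    + by apply: cvg_at_right_filter; exact: cF.
    + by apply: cvg_at_left_filter; exact: cF.
  - exact: continuous_subspaceT.
rewrite [RHS]integral_mkcond; apply: eq_integral => x _.
rewrite patchE F0 Fpi mem_setE /G -semicircle_pdfE//.
case: ifPn => // xr; rewrite semicircle_pdfE// semicircle_sqrt_eq0 ?mulr0//.
by apply: contra xr; exact: subset_itv_oo_cc.
Qed.

End Semicircle.

Section Density.
Context {R : realType}.
Local Notation mu := (@lebesgue_measure R).

(** [g] and the Radon-Nikodym derivative of [nu] have the same integral over every measurable set,
    hence agree almost everywhere. *)
Lemma integral_density (nu : {finite_measure set (measurableTypeR R) -> \bar R})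
    (g : R -> R) (f : R -> \bar R) :
  (forall x, 0 <= g x) -> measurable_fun [set: measurableTypeR R] g ->
  (forall A, measurable A -> nu A = \int[mu]_(x in A) (g x)%:E)%E ->
  nu.-integrable setT f ->
  (\int[nu]_x f x = \int[mu]_x (f x * (g x)%:E))%E.
Proof.
move=> g0 mg nuE intf.
have dom : nu `<< mu.
  apply/null_content_dominatesP => A mA muA0; rewrite nuE//.
  by apply: null_set_integral => //; apply/measurable_EFinP; exact: measurable_funTS.
have mf : measurable_fun setT f by exact: measurable_int intf.
rewrite -(Radon_Nikodym_change_of_variables dom)//=.
apply: ae_eq_integral => //.
- by apply: emeasurable_funM => //; apply: (measurable_int mu);
    exact: Radon_Nikodym_integrable.
- by apply: emeasurable_funM => //; exact/measurable_EFinP.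
- apply: ae_eqe_mul2l => /=; apply: integral_ae_eq => //=.
  + exact: Radon_Nikodym_integrable.
  + exact/measurable_EFinP.
  + by move=> E _ mE; rewrite -Radon_Nikodym_integral//; exact: nuE.
Qed.

Lemma integral_itv_EFin (f : R -> R) (a b : R) : continuous f ->
  (\int[mu]_(x in `[a, b]) (f x)%:E = (\int[mu]_(x in `[a, b]) f x)%R%:E)%E.
Proof.
move=> cf; rewrite /Rintegral fineK//; apply: integrable_fin_num => //.
apply: continuous_compact_integrable; first exact: segment_compact.
exact: continuous_subspaceT.
Qed.

End Density.

Section SemicircleMoments.
Context {R : realType}.
Local Notation mu := (@lebesgue_measure R).

(** As sin((k+1)t) = U_k(cos t) sin t with U_k the Chebyshev polynomial of the second kind, for r >
    0 this is the integral of x^n r^k U_k(x / (2r)) under the semi-circle law. *)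
Definition semicircle_sin (r : R) (n k : nat) : R :=
  \int[mu]_(t in `[0, pi])
    ((2 * r * cos t) ^+ n * (2 / pi * r ^+ k * (sin (k.+1%:R * t) * sin t))).

Let continuous_semicircle_sin (r : R) n k : continuous (fun t : R =>
  (2 * r * cos t) ^+ n * (2 / pi * r ^+ k * (sin (k.+1%:R * t) * sin t))).
Proof.
move=> t; apply: cvgM.
  apply: (continuous_comp (f := fun t : R => 2 * r * cos t)
    (g := fun x : R => x ^+ n)).
    by apply: cvgMr; exact: continuous_cos.
  exact: exprn_continuous.
apply: cvgMr; apply: cvgM; [exact: continuous_sinM|exact: continuous_sin].
Qed.

Let integrable_cont (f : R -> R) (a b : R) : continuous f ->
  mu.-integrable `[a, b] (EFin \o f).
Proof.
move=> cf; apply: continuous_compact_integrable; first exact: segment_compact.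
exact: continuous_subspaceT.
Qed.

Lemma semicircle_sin0 r k : semicircle_sin r 0 k = (k == 0)%:R.
Proof.
rewrite /semicircle_sin; under eq_Rintegral do rewrite expr0 mul1r.
rewrite RintegralZl//; last first.
  apply: integrable_cont => t.
  by apply: cvgM; [exact: continuous_sinM|exact: continuous_sin].
rewrite integral_sinM_sin; case: k => [|k]; last by rewrite mulr0.
rewrite expr0 mulr1 mulr1n mulrA mulfVK ?divff// ?gt_eqF// pi_gt0//.
Qed.

Lemma semicircle_sinS0 r n : semicircle_sin r n.+1 0 = semicircle_sin r n 1.
Proof.
apply: eq_Rintegral => t _.
by rewrite mul1r (mulr_natl t) sin_mulr2n exprS; ring.
Qed.

(** The three-term recursion of the U_k: sin((k+3)t) + sin((k+1)t) = 2 cos t sin((k+2)t). *)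
Lemma semicircle_sinSS r n k : semicircle_sin r n.+1 k.+1 =
  semicircle_sin r n k.+2 + r ^+ 2 * semicircle_sin r n k.
Proof.
rewrite /semicircle_sin -RintegralZl//; last exact: integrable_cont.
rewrite -RintegralD//; [|exact: integrable_cont|]; last first.
  apply: integrable_cont => t; apply: cvgMr; exact: continuous_semicircle_sin.
apply: eq_Rintegral => t _.
rewrite (_ : k.+3%:R * t = k.+2%:R * t + t); last by rewrite -(natr1 k.+2); ring.
rewrite (_ : k.+1%:R * t = k.+2%:R * t - t); last by rewrite -(natr1 k.+1); ring.
by rewrite sinB sinD !exprS; ring.
Qed.

Lemma integral_semicircle_pdf_pow (r : R) n : 0 < r ->
  (\int[mu]_x (x ^+ n * semicircle_pdf r x)%:E = (semicircle_sin r n 0)%:E)%E.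
Proof.
move=> r0; rewrite (integral_semicircle_cos (p := fun x => x ^+ n))//; last first.
  exact: exprn_continuous.
rewrite /semicircle_sin -integral_itv_EFin//; apply: eq_integral => t _.
by rewrite mul1r expr0 mulr1.
Qed.

Lemma semicircle_lawT (r : R) : 0 < r -> semicircle_law r setT = 1%E.
Proof.
(* The mass is the moment of order 0; [true%:R] is the right-hand side of [semicircle_sin0] at k =
   0. *)
move=> r0; rewrite /semicircle_law -[RHS]/((true%:R : R)%:E).
rewrite -(semicircle_sin0 r 0) -integral_semicircle_pdf_pow//.
by apply: eq_integral => x _; rewrite expr0 mul1r.
Qed.

Lemma semicircle_law_support (r : R) : 0 < r ->
  semicircle_law r (~` `[- (2 * r), 2 * r]) = 0%E.
Proof.
move=> r0; apply: integral0_eq => x /= xr.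
rewrite semicircle_pdfE// semicircle_sqrt_eq0 ?mulr0//.
by apply/negP => /subset_itv_oo_cc.
Qed.

Lemma integral_semicircle_law_pow (r : R) n : 0 < r ->
  (semicircle_law r).-integrable setT (fun x : R => (x ^+ n)%:E) ->
  \int[semicircle_law r]_x (x ^+ n) = semicircle_sin r n 0.
Proof.
move=> r0 intx.
(* [integral_density] takes a finite measure, so the law is packed as a probability. *)
pose P : probability (measurableTypeR R) R :=
  HB.pack (semicircle_law r) (Measure_isProbability.Build _ _ _ _ (semicircle_lawT r0)).
rewrite /Rintegral -[LHS]/(fine (\int[P]_x (x ^+ n)%:E)%E).
rewrite (@integral_density _ P (semicircle_pdf r))//.
- by rewrite integral_semicircle_pdf_pow.
- exact: semicircle_pdf_ge0.
- exact: measurable_semicircle_pdf.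
Qed.

End SemicircleMoments.

(** * Two-point law *)

Section TwoPoint.
Context {R : realType}.

(** The integrand is almost everywhere the constant [f a]. *)
Lemma integral_point_mass (m : {measure set (measurableTypeR R) -> \bar R}) (a : R)
    (f : R -> \bar R) :
  m (~` [set a]) = 0%E -> measurable_fun [set: measurableTypeR R] f ->
  (\int[m]_x f x = f a * m setT)%E.
Proof.
move=> ma mf; rewrite -integral_cst//.
apply: ae_eq_integral => //; exists (~` [set a]); split => //.
  by apply: measurableC; exact: measurable_set1.
by move=> x /=; apply: contra_not => -> _.
Qed.

Lemma two_point_lawE (r : R) (A : set R) :
  two_point_law r A = ((2^-1)%:E * \d_(- r)%R A + (2^-1)%:E * \d_r A)%E.
Proof. exact: measure_addE. Qed.

Lemma mscale_dirac_setC1 (c : {nonneg R}) (a : R) :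
  mscale c (\d_(a : measurableTypeR R)) (~` [set a]) = 0%E.
Proof.
by rewrite /mscale/= diracE memNset ?mule0//; apply.
Qed.

Lemma mscale_diracT (c : {nonneg R}) (a : R) :
  mscale c (\d_(a : measurableTypeR R)) setT = (c%:num)%:E.
Proof. by rewrite /mscale/= diracT mule1. Qed.

Lemma two_point_lawT (r : R) : two_point_law r setT = 1%E.
Proof.
by rewrite two_point_lawE !diracT !mule1 -EFinD; congr EFin; lra.
Qed.

Lemma two_point_law_support (r : R) : 0 < r ->
  two_point_law r (~` `[- r, r]) = 0%E.
Proof.
move=> r0; have rr : - r <= r by lra.
by rewrite two_point_lawE !diracE !memNset ?mule0 ?adde0//=;
  apply; rewrite in_itv/= lexx ?rr.
Qed.

Lemma integral_two_point_law_pow (r : R) n :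
  \int[two_point_law r]_x (x ^+ n) = 2^-1 * (- r) ^+ n + 2^-1 * r ^+ n.
Proof.
have mpow : measurable_fun [set: measurableTypeR R] (fun x : R => (x ^+ n)%:E).
  by apply/measurable_EFinP; exact: exprn_measurable.
have intpow (c : {nonneg R}) (a : R) :
    (mscale c (\d_(a : measurableTypeR R))).-integrable setT (fun x : R => (x ^+ n)%:E).
  apply/integrableP; split => //.
  rewrite (integral_point_mass (f := fun x => `|(x ^+ n)%:E|%E) (mscale_dirac_setC1 c a)).
    by rewrite [X in (_ * X)%E](mscale_diracT c a) ltry.
  exact: measurableT_comp.
rewrite /Rintegral /two_point_law integral_measure_add//.
- rewrite !(integral_point_mass (mscale_dirac_setC1 _ _))//.
  rewrite [X in (_ * X + _)%E]mscale_diracT [X in (_ + _ * X)%E]mscale_diracT/=.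
  by rewrite ![_ * 2^-1]mulrC.
- exact: intpow.
- exact: intpow.
Qed.

End TwoPoint.

(** * From moments to the vacuum distribution *)

Lemma is_distribution_bounded_support (R : realType) (V : hilbertType R) (Phi : V)
    (X : V -> V) (mu : {measure set (measurableTypeR R) -> \bar R}) (K : R) :
  0 < K -> mu setT = 1%E -> mu (~` `[- K, K]) = 0%E ->
  (forall n, (\int[mu]_x (x ^+ n))%:C%C = [< Phi, iter n X Phi >]) ->
  is_distribution Phi X mu.
Proof.
move=> K0 mu1 muK momE; split.
  by split => // n; split; [exact: integrable_pow_bounded_support muK n|].
move=> nu [nu1 nuE].
have mom n : \int[nu]_x (x ^+ n) = \int[mu]_x (x ^+ n).
  by apply: (fmorph_inj (real_complex R)); rewrite /= momE; case: (nuE n).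
have mK : measurable (`[- K, K]%classic : set (measurableTypeR R)).
  exact: measurable_itv.
(* The moments of order 2n are at most K^(2n) because [mu] lives on [-K, K]. [support_of_moments]
   wants a bound strictly above K, and K + 1 is one. *)
have nuK : nu (~` `[- (K + 1), K + 1]) = 0%E.
  apply: (@support_of_moments _ _ K) => [| |n|n]; [exact: ltW|by rewrite ltrDl| |].
    by case: (nuE n).
  rewrite mom (Rintegral_pow_bounded_support mu1 muK).
  have muD : fine (mu `[- K, K]%classic) <= 1.
    have leD : (mu `[(- K)%R, K]%classic <= 1)%E by rewrite -mu1 le_measure ?inE.
    by rewrite -lee_fin fineK// ge0_fin_numE// (le_lt_trans leD) ?ltry.
  apply: (@le_trans _ _ (\int[mu]_(x in `[- K, K]) (K ^+ (2 * n)))).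
    apply: le_Rintegral => //.
    - by apply: integrableS (integrable_pow_bounded_support mu1 muK _).
    - have := integrable_horner mu1 muK (K ^+ (2 * n))%:P mK.
      by under [X in integrable _ _ X -> _]eq_fun do rewrite hornerC.
    move=> x /=; rewrite in_itv/= -ler_norml => xK.
    rewrite (le_trans (ler_norm _))// normrX.
    by rewrite lerXn2r// nnegrE// ltW.
  by rewrite Rintegral_cst// -[leRHS]mulr1 ler_wpM2l// exprn_ge0// ltW.
apply: (@moments_unique _ nu mu (K + 1)) => //; first exact: addr_gt0.
apply: subset_measure0 muK.
- by apply: measurableC; exact: measurable_itv.
- exact: measurableC.
- apply: subsetC; apply: subset_itv; rewrite bnd_simp ?lerN2 lerDl//.
Qed.

Theorem proposition3p1 (R : realType) (H : hilbertType R)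
    (dimH : exists u v : H, forall a b : R[i], a *: u + b *: v = 0 -> a = 0 /\ b = 0)
    (q : R) (q_itv : -1 <= q <= 1)
    (F : fock_space H q)
    (f : H) (f_neq0 : f != 0)
    (Ap Am : {linear fock_carrier F -> fock_carrier F})
    (creation_f : is_creation f Ap) (annihilation_f : is_adjoint Ap Am) :
  (q = -1 ->
     is_distribution (vacuum F) (field_operator Am Ap) (two_point_law (hnorm f))) /\
  (q = 0 ->
     is_distribution (vacuum F) (field_operator Am Ap) (semicircle_law (hnorm f))).
Proof.
have r0 : 0 < hnorm f by rewrite -ltcR hnormE normr_gt0.
split=> q_eq; subst q.
  apply: (is_distribution_bounded_support r0 (two_point_lawT _)).
    exact: two_point_law_support.
  move=> n; rewrite integral_two_point_law_pow.
  rewrite (field_moments_two_point creation_f annihilation_f)//.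
  exact: fock_tens_sqr_eq0.
have K0 : 0 < 2 * hnorm f by rewrite mulr_gt0.
have lawT := semicircle_lawT r0; have lawK := semicircle_law_support r0.
apply: (is_distribution_bounded_support K0 lawT lawK) => n.
rewrite integral_semicircle_law_pow//; last first.
  exact: (integrable_pow_bounded_support lawT lawK).
(* The integrals solve the recursion of <Phi, X^n e_k>; at k = 0 it remains to identify e_0 with the
   vacuum. *)
rewrite -(field_moments_ballot creation_f annihilation_f (semicircle_sin0 _)
  (semicircle_sinS0 _) (semicircle_sinSS _)).
by congr ([< _, iter n _ (fock_tens F _) >]); exact: val_inj.
Qed.
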